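(* Let $G$ be a cactus graph with at least two vertices. Then $G$ has an independent $[1,2]$-set if and only if there exists a spanning tree $T$ of $G$ satisfying $T\in\mathcal{F}_2$ and having a generating family $\mathcal{G}(T)=\{T_1,\dots,T_t\}$, with $V(T_j)=X_j\cup Y_j$ the bipartition of $T_j$ into a $p_2$-set $X_j$ and an independent $[1,2]$-set $Y_j$ (for $j=1,\dots,t$), such that every edge $e\in E(G)\setminus E(T)$ satisfies one of the following: either both endpoints of $e$ belong to $\bigcup_{j=1}^{t}X_j$ (type A edge), or the endpoints of $e$ can be named $u,v$ (so $e=uv$) in such a way that there exists $j_e\in\{1,\dots,t\}$ for which $u$ is a leaf of $T_{j_e}$, $u\in X_{j_e}$ and $v\in Y_{j_e}$ (type B edge).
   Context: All graphs are finite, undirected, simple and connected. A graph $G$ is a cactus graph if every edge of $G$ belongs to at most one cycle. For a graph $G=(V,E)$ and $v\in V$, $N(v)$ is the set of neighbors of $v$. A set $S\subseteq V$ is an independent $[1,2]$-set of $G$ if no two vertices of $S$ are adjacent and every vertex $v\in V\setminus S$ satisfies $1\le |N(v)\cap S|\le 2$. A leaf is a vertex of degree $1$. A $p_2$-tree is a non-trivial tree (at least two vertices) such that, in the unique bipartition of its vertex set into two partite sets, every vertex in one of the partite sets has degree at most $2$ (in that tree); such a partite set is called a $p_2$-set. If $V(T)=X\cup Y$ is the bipartition and $X$ is a $p_2$-set, then $Y$ is an independent $[1,2]$-set of $T$. A generating family of a tree $T$ is a family $\mathcal{G}(T)=\{T_1,\dots,T_t\}$ ($t\ge 1$) of pairwise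 vertex-disjoint $p_2$-trees, each with a bipartition $V(T_i)=X_i\cup Y_i$ in which $X_i$ is a $p_2$-set of $T_i$, such that $T$ is obtained from the disjoint union of $T_1,\dots,T_t$ by adding $t-1$ edges, each of which joins vertices in two different sets $X_i$ and $X_j$ ($i\ne j$). $\mathcal{F}_2$ denotes the family of trees having a generating family. *)

(* Defs.v *)
From HB Require Import structures.
From mathcomp Require Import all_boot.

Set Implicit Arguments.
Unset Strict Implicit.
Unset Printing Implicit Defensive.

(* Finite simple graphs whose vertices are drawn from an ambient finType V, so
   that a graph and its subgraphs share one type; an edge is a 2-element set. *)
Record graph (V : finType) := Graph {
  verts : {set V};
  edges : {set {set V}};
  edgesP : forall e, e \in edges -> #|e| = 2 /\ e \subset verts
}.

Section Graphs.
Variable V : finType.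
Implicit Types (G T : graph V) (S X Y : {set V}) (u v : V) (c : seq V).

Definition adj G : rel V := fun u v => [set u; v] \in edges G.

Definition nbrs G v : {set V} := [set w | adj G v w].

Definition deg G v : nat := #|nbrs G v|.

Definition leaf G v : Prop := deg G v = 1.

Definition connected G : Prop :=
  forall u v, u \in verts G -> v \in verts G -> connect (adj G) u v.

Definition is_cycle G c : Prop := 2 < size c /\ ucycle (adj G) c.

Definition cycle_edges c : {set {set V}} := [set [set v; next c v] | v in c].

(* Rotations and reversals of c list the same cycle; a cycle is determined by
   its edge set, so cycles are compared through cycle_edges. *)
Definition cactus G : Prop :=
  connected G /\
  forall (e : {set V}) (c1 c2 : seq V),
    e \in edges G -> is_cycle G c1 -> is_cycle G c2 ->
    e \in cycle_edges c1 -> e \in cycle_edges c2 ->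
    cycle_edges c1 = cycle_edges c2.

Definition tree T : Prop := connected T /\ forall c, ~ is_cycle T c.

Definition spanning_tree G T : Prop :=
  [/\ verts T = verts G, edges T \subset edges G & tree T].

Definition independent G S : Prop :=
  forall u v, u \in S -> v \in S -> ~~ adj G u v.

Definition independent12 G S : Prop :=
  [/\ S \subset verts G, independent G S
    & forall v, v \in verts G :\: S -> 1 <= #|nbrs G v :&: S| <= 2].

Definition bipartition G X Y : Prop :=
  [/\ X :|: Y = verts G, [disjoint X & Y], independent G X & independent G Y].

Definition p2_set T X : Prop :=
  (exists Y, bipartition T X Y) /\ forall v, v \in X -> deg T v <= 2.

Definition p2_tree T : Prop :=
  [/\ tree T, 1 < #|verts T| & exists X, p2_set T X].

Definition generating_family T t (F : 'I_t -> graph V) (X Y : 'I_t -> {set V})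
    : Prop :=
  [/\ 0 < t,
      forall i, [/\ p2_tree (F i), bipartition (F i) (X i) (Y i)
                  & p2_set (F i) (X i)],
      forall i j, i != j -> [disjoint verts (F i) & verts (F j)],
      verts T = \bigcup_(i < t) verts (F i)
    & exists A : {set {set V}},
        [/\ #|A| = t.-1,
            edges T = (\bigcup_(i < t) edges (F i)) :|: A
          & forall e, e \in A -> exists u v i j,
              [/\ e = [set u; v], i != j, u \in X i & v \in X j]]].

Definition in_F2 T : Prop :=
  tree T /\ exists t (F : 'I_t -> graph V) (X Y : 'I_t -> {set V}),
    generating_family T F X Y.

Definition typeA t (X : 'I_t -> {set V}) (e : {set V}) : Prop :=
  e \subset \bigcup_(j < t) X j.

Definition typeB t (F : 'I_t -> graph V) (X Y : 'I_t -> {set V})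
    (e : {set V}) : Prop :=
  exists u v j, [/\ e = [set u; v], leaf (F j) u, u \in X j & v \in Y j].

End Graphs.

(* Main.v *)
Require Import Defs.
From mathcomp Require Import all_boot.

(** Suppose S is an independent [1,2]-set of G.  Every edge of G either joins S
    to its complement or avoids S; let H consist of the edges of the first
    kind, and take a spanning forest E of H ([independent12_forest]).  The
    pieces F i are the components of E, split into X i, the part outside S, and
    Y i, the part inside S.  A vertex u outside S has one or two neighbours in
    S, so its degree in its piece is at most 2.  It is never isolated in E,
    because E has the same components as H; hence an edge uv of H left out of E
    comes from a vertex u of H-degree 2 and E-degree 1, a leaf of its piece,
    while v is in the same piece: a type B edge.  Every other edge of G avoids S
    and is of type A.  Growing E to a spanning tree of G adds only edges between
    different components of E, hence edges avoiding S, and each of them lowers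
    the number of components by one, so that there are t - 1 of them
    ([forest_extension], [independent12_family]).

    Conversely let S be the union of the sets Y j.  The tree edges and the edges
    of types A and B all have at most one end in S, so S is independent.  A
    vertex v of X j has its one or two neighbours in the tree F j, all in Y j;
    its remaining neighbours in S come from type B edges, and then v is a leaf
    of F j.  Each type B edge at v closes a cycle through the only edge of F j
    at v, so in a cactus there is at most one ([cactus_one_chord]), and v has at
    most two neighbours in S altogether ([family_independent12]). *)

Set Implicit Arguments.
Unset Strict Implicit.
Unset Printing Implicit Defensive.

(** * Forests as edge sets *)

Section EdgeSets.
Variable V : finType.
Implicit Types (E : {set {set V}}) (W : {set V}) (u v w : V) (G F : graph V).

(** Forests grow by one edge at a time, which is lighter on bare edge sets than
    on graphs; [adj G] is convertible to [eadj (edges G)]. *)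
Definition eadj E : rel V := fun u v => [set u; v] \in E.

Definition acyclic E : Prop :=
  forall c, ~ (2 < size c /\ ucycle (eadj E) c).

Definition comp E v : {set V} := [set w | connect (eadj E) v w].

Definition comps E W : {set {set V}} := [set comp E v | v in W].

Lemma eadj_sym E : symmetric (eadj E).
Proof. by move=> u v; rewrite /eadj setUC. Qed.

Lemma connect_eadj_sym E : connect_sym (eadj E).
Proof. exact: sym_connect_sym (eadj_sym E). Qed.

Lemma eadjS E1 E2 : E1 \subset E2 -> subrel (eadj E1) (eadj E2).
Proof. by move=> /subsetP sE u v /sE. Qed.

Lemma connect_eadjS E1 E2 :
  E1 \subset E2 -> subrel (connect (eadj E1)) (connect (eadj E2)).
Proof. by move=> sE; apply: connect_sub => u v /(eadjS sE)/connect1. Qed.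

Lemma acyclicS E1 E2 : E1 \subset E2 -> acyclic E2 -> acyclic E1.
Proof.
move=> sE acE c [c2 /andP[cyc_c Uc]]; apply: (acE c).
by split=> //; rewrite /ucycle (sub_cycle (eadjS sE)).
Qed.

Lemma eq_set2 u v x y :
  [set x; y] = [set u; v] -> (x = u /\ y = v) \/ (x = v /\ y = u).
Proof.
move=> /setP eqE.
have: u \in [set x; y] by rewrite eqE set21.
have: v \in [set x; y] by rewrite eqE set22.
have: x \in [set u; v] by rewrite -eqE set21.
have: y \in [set u; v] by rewrite -eqE set22.
rewrite !inE; do 4![case/orP=> /eqP ?]; subst; by auto.
Qed.

Lemma eadj_add E u v x y :
  eadj ([set u; v] |: E) x y ->
  eadj E x y \/ (x = u /\ y = v) \/ (x = v /\ y = u).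
Proof. by rewrite /eadj in_setU1 => /orP[/eqP/eq_set2|]; auto. Qed.

Lemma connect_step (e : rel V) u v : connect e u v -> u != v -> exists w, e u w.
Proof.
case/connectP=> -[|w p] /=; first by move=> _ ->; rewrite eqxx.
by case/andP=> euw _ _ _; exists w.
Qed.

Lemma comp_eq E v w : (comp E v == comp E w) = connect (eadj E) v w.
Proof.
apply/eqP/idP=> [eqC|cvw].
  have: w \in comp E w by rewrite inE.
  by rewrite -eqC inE.
by apply/setP=> x; rewrite !inE; apply: (same_connect (connect_eadj_sym E)).
Qed.

(** A cycle of the enlarged edge set must use uv; going round the rest of it
    connects v to u inside E. *)
Lemma acyclic_add E u v :
  acyclic E -> ~~ connect (eadj E) u v -> acyclic ([set u; v] |: E).
Proof.
move=> acE ncuv c [c2 /andP[cyc_c Uc]].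
have [/allP inE' | /allPn[x cx nEx]] :=
  boolP (all (fun x => eadj E x (next c x)) c).
  by apply: (acE c); split=> //; rewrite /ucycle Uc andbT; apply: cycle_from_next.
have [//|exy] := eadj_add (next_cycle cyc_c cx); first by rewrite (negPf nEx).
have [i p def_c] := rot_to cx.
rewrite -(next_rot i Uc) in exy nEx.
move: c2 Uc cyc_c; rewrite -(size_rot i) -(rot_uniq i) -(rot_cycle i).
rewrite {}def_c in exy nEx *.
case: p exy nEx => [|y [|z p]] //=; rewrite eqxx => exy nEx _.
rewrite !inE !negb_or -!andbA => /and5P[nxy nxz xp nyz /and3P[yp zp Up]].
case/and3P=> _ Eyz Ep.
case/negP: ncuv.
(* The new edge is {x, y}: a step that avoids y is therefore a step of E.  The
   rest of the cycle starts at y, leaves it for z <> x and never returns. *)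
have keep a b : a != y -> b != y -> eadj ([set u; v] |: E) a b -> eadj E a b.
  move=> ay bY /eadj_add[//|]; case: exy => -[xu yv]; subst;
  by case=> -[ea eb]; subst; rewrite eqxx in ay bY.
have cyx : connect (eadj E) y x.
  apply/connectP; exists (z :: rcons p x); rewrite /= ?last_rcons //.
  apply/andP; split.
    case: (eadj_add Eyz) => // ez; case/negP: nxz; apply/eqP.
    by move: exy nxy ez => [][-> ->] nxy [][] *; subst => //; rewrite eqxx in nxy.
  apply: (@sub_in_path _ [pred a | a != y]) Ep; first by move=> a b; apply: keep.
  rewrite /= all_rcons /= nxy eq_sym nyz /=; apply/allP=> a ap /=.
  by apply: contraNneq yp => <-.
by case: exy => -[<- <-] //; rewrite connect_eadj_sym.
Qed.

Lemma mem_comps E W v : v \in W -> comp E v \in comps E W.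
Proof. exact: imset_f. Qed.

(** A path starting outside the components of u and v never gets to use uv. *)
Lemma comp_add E u v w :
  ~~ connect (eadj E) w u -> ~~ connect (eadj E) w v ->
  comp ([set u; v] |: E) w = comp E w.
Proof.
move=> nwu nwv; apply/setP=> x; rewrite !inE.
apply/idP/idP; last exact: (connect_eadjS (subsetUr _ _)).
case/connectP=> p + ->; have: connect (eadj E) w w by apply: connect0.
move: {2 3 5}w => a; elim: p a => //= b p IHp a cwa /andP[/eadj_add eab].
apply: IHp; case: eab => [eab|]; first exact: connect_trans (connect1 eab).
by case=> -[ea _]; rewrite -ea cwa in nwu nwv.
Qed.

(** The components of u and v merge into one and the others stay as they are. *)
Lemma card_comps_add E W u v :
  u \in W -> v \in W -> ~~ connect (eadj E) u v ->
  #|comps ([set u; v] |: E) W|.+1 = #|comps E W|.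
Proof.
move=> Wu Wv ncuv; set E' := _ |: E.
have Euv : eadj E' u v by rewrite /eadj setU11.
have Evu : eadj E' v u by rewrite eadj_sym.
have sEE' : subrel (connect (eadj E)) (connect (eadj E')).
  exact: connect_eadjS (subsetUr _ _).
(* Discard the merged component on one side, its two parts on the other. *)
rewrite (cardsD1 (comp E' u) (comps E' W)) mem_comps //.
rewrite (cardsD1 (comp E u) (comps E W)) mem_comps //.
rewrite (cardsD1 (comp E v) (comps E W :\ _)) in_setD1 mem_comps // comp_eq.
rewrite connect_eadj_sym ncuv !add1n; congr (_.+2).
apply: eq_card => C; rewrite !inE.
apply/andP/and3P=> [[nC /imsetP[w Ww defC]]|[nCv nCu /imsetP[w Ww defC]]].
  rewrite {C}defC comp_eq in nC *.
  have nwu : ~~ connect (eadj E) w u by apply: contra nC => /sEE'.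
  have nwv : ~~ connect (eadj E) w v.
    by apply: contra nC => /sEE'/connect_trans->//; apply: connect1.
  by rewrite comp_add // !comp_eq imset_f.
rewrite {C}defC !comp_eq in nCv nCu *.
rewrite -(comp_add nCu nCv) comp_eq mem_comps //; split=> //.
have := comp_add nCu nCv; rewrite -/E' => /setP/(_ u).
by rewrite !inE (negPf nCu) => ->.
Qed.

(** Add edges of E that join different components as long as there are any.
    Recording the number of components at each step gives the size of A without
    an edge count for forests.  With E0 empty this yields a spanning forest of
    E, and with E0 a forest it extends E0 to a spanning forest of E0 and E. *)
Lemma forest_extension E0 E W :
  (forall u v, eadj E u v -> u \in W) -> acyclic E0 ->
  exists A : {set {set V}},
    [/\ A \subset E, acyclic (E0 :|: A),
        subrel (eadj E) (connect (eadj (E0 :|: A))),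
        #|A| + #|comps (E0 :|: A) W| = #|comps E0 W|
      & forall u v, eadj A u v -> ~~ connect (eadj E0) u v].
Proof.
move=> EW; have [n] := ubnP #|comps E0 W|; elim: n E0 => // n IHn E0 le_n acE0.
have [/forallP cE|] :=
  boolP [forall u, forall v, eadj E u v ==> connect (eadj E0) u v].
  exists set0; rewrite setU0 sub0set cards0; split=> //.
    by move=> u v; apply/implyP; move/forallP: (cE u).
  by move=> u v; rewrite /eadj inE.
rewrite negb_forall => /existsP[u]; rewrite negb_forall => /existsP[v].
rewrite negb_imply => /andP[Euv ncuv].
have Wu := EW _ _ Euv; have Wv : v \in W by apply: (EW v u); rewrite eadj_sym.
have nc := card_comps_add Wu Wv ncuv; set E1 := _ |: E0 in nc.
have [||A [sAE acA cA cardA joinA]] := IHn E1; first by rewrite -nc in le_n.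
  exact: acyclic_add.
have AuvN : [set u; v] \notin A.
  apply/negP=> /joinA/negP[]; apply: connect1; exact: setU11.
have defE : E0 :|: ([set u; v] |: A) = E1 :|: A by rewrite setUCA setUA.
exists ([set u; v] |: A); rewrite defE; split=> //.
- by rewrite subUset sub1set sAE andbT.
- by rewrite cardsU1 AuvN -nc -cardA addSn.
move=> x y /eadj_add[/joinA|[] [-> ->]] //; last by rewrite connect_eadj_sym.
by apply: contra; apply: connect_eadjS; apply: subsetUr.
Qed.

End EdgeSets.

(** * Subgraphs and chords *)

Section Subgraphs.
Variable V : finType.
Implicit Types (E : {set {set V}}) (C S X Y : {set V}) (u v w : V).
Implicit Types (G F : graph V).

Lemma adj_neq G u v : adj G u v -> u != v.
Proof. by move=> /edgesP[]; rewrite cards2; case: eqP. Qed.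

Lemma adj_verts G u v : adj G u v -> u \in verts G /\ v \in verts G.
Proof. by move=> /edgesP[_]; rewrite subUset !sub1set => /andP. Qed.

Lemma edge_adj G e : e \in edges G -> exists u v, e = [set u; v] /\ adj G u v.
Proof.
move=> Ge; have [/eqP/cards2P[u [v [_ def_e]]] _] := edgesP Ge.
by exists u, v; rewrite /adj -def_e.
Qed.

Lemma adj_sym G : symmetric (adj G).
Proof. exact: eadj_sym. Qed.

Lemma connected_has_nbr G v :
  connected G -> 1 < #|verts G| -> v \in verts G -> exists w, adj G v w.
Proof.
move=> conG; rewrite (cardsD1 v) => /[swap] Gv.
rewrite Gv ltnS card_gt0 => /set0Pn[w /setD1P[wv Gw]].
by apply: (connect_step (conG v w Gv Gw)); rewrite eq_sym.
Qed.

Lemma edge_subgraphP G E e :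
  e \in edges G :&: E -> #|e| = 2 /\ e \subset verts G.
Proof. by case/setIP=> /edgesP. Qed.

Definition edge_subgraph G E : graph V := Graph (@edge_subgraphP G E).

Lemma inducedP G C e :
  e \in [set e in edges G | e \subset C] -> #|e| = 2 /\ e \subset C.
Proof. by rewrite inE => /andP[/edgesP[]]. Qed.

Definition induced G C : graph V := Graph (@inducedP G C).

Lemma adj_induced G C u v :
  adj (induced G C) u v = [&& adj G u v, u \in C & v \in C].
Proof. by rewrite /adj /= inE subUset !sub1set. Qed.

(** A path starting in a component never leaves it. *)
Lemma induced_comp_connected G v : connected (induced G (comp (edges G) v)).
Proof.
set C := comp _ v; suff cv w : w \in C -> connect (adj (induced G C)) v w.
  move=> x y /= /cv cvx /cv; apply: connect_trans.
  by rewrite (connect_eadj_sym (edges (induced G C))).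
rewrite inE => /connectP[p + ->]; have: v \in C by rewrite inE connect0.
elim: p {1 2 3 4}v => //= x p IHp a Ca /andP[ax /IHp cxp].
have Cx : x \in C.
  by move: Ca; rewrite !inE => /connect_trans; apply; apply: connect1.
apply: connect_trans (cxp Cx); apply: connect1; rewrite adj_induced Ca Cx.
by rewrite !andbT.
Qed.

(** A path of F from u to v has to start with the only edge uw0 of F at u; the
    chord uv closes it into a cycle. *)
Lemma closing_cycle G F u v w0 :
  connected F -> edges F \subset edges G -> u \in verts F -> v \in verts F ->
  (forall w, adj F u w -> w = w0) -> adj G u v -> ~~ adj F u v ->
  exists c, [/\ is_cycle G c, [set u; w0] \in cycle_edges c,
    [set u; v] \in cycle_edges c
    & forall e, e \in cycle_edges c -> e \in edges F \/ e = [set u; v]].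
Proof.
move=> conF sFG Fu Fv w0P Guv nFuv.
have uv := adj_neq Guv.
case/connectP: (conF _ _ Fu Fv) => p0 Fp0.
case/shortenP: Fp0 => p Fp Up _ def_v {p0}.
case: p => [|w p] in Fp Up def_v *; first by rewrite def_v eqxx in uv.
have /andP[Fuw _] := Fp.
have defw := w0P _ Fuw; subst w0.
(* Reading the cycle through r rather than adj G records where each edge comes
   from. *)
pose r x y := adj F x y || ([set x; y] == [set u; v]).
have rc : cycle r (u :: w :: p).
  rewrite /cycle rcons_path -def_v {2}/r setUC eqxx orbT andbT.
  by apply: sub_path Fp => x y; rewrite /r => ->.
have rG : subrel r (adj G).
  by move=> x y /orP[|/eqP]; rewrite /adj; [apply: (subsetP sFG) | move->].
exists (u :: w :: p); split.
- split; last by rewrite /ucycle (sub_cycle rG rc).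
  by case: p def_v nFuv {rc Up Fp} => //= ->; rewrite Fuw.
- by apply/imsetP; exists u; rewrite ?mem_head //= eqxx.
- have cv : v \in u :: w :: p by rewrite def_v; apply: mem_last.
  apply/imsetP; exists v => //.
  rewrite setUC; congr [set _; _].
  (* v is the last vertex, and the default value of nth is the first one. *)
  by rewrite next_nth cv {1}def_v index_last //= nth_default.
move=> e /imsetP[x cx ->].
by have /orP[|/eqP] := next_cycle rc cx; [left | right].
Qed.

(** The cycles closed by the chords uv1 and uv2 share the edge of F at the leaf
    u, so they coincide; but uv1 is the only edge of the first cycle outside F.
    *)
Lemma cactus_one_chord G F u v1 v2 :
  cactus G -> connected F -> edges F \subset edges G -> leaf F u ->
  v1 \in verts F -> v2 \in verts F ->
  adj G u v1 -> adj G u v2 -> ~~ adj F u v1 -> ~~ adj F u v2 -> v1 = v2.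
Proof.
move=> [_ cacG] conF sFG /eqP/cards1P[w nu] Fv1 Fv2 G1 G2 nF1 nF2.
have Fuw : adj F u w.
  by have /setP/(_ w) := nu; rewrite !inE eqxx.
have Fu : u \in verts F by case: (adj_verts Fuw).
have wP x : adj F u x -> x = w.
  by move=> ux; apply/set1P; rewrite -nu inE.
have [c1 [cyc1 w1 e1 sub1]] := closing_cycle conF sFG Fu Fv1 wP G1 nF1.
have [c2 [cyc2 w2 e2 _]] := closing_cycle conF sFG Fu Fv2 wP G2 nF2.
have eqc := cacG _ _ _ (subsetP sFG _ Fuw) cyc1 cyc2 w1 w2.
rewrite -eqc in e2; case: (sub1 _ e2) => [Fe|/eq_set2[[]//|[uv _]]].
  by rewrite /adj Fe in nF2.
by have := adj_neq G1; rewrite -uv eqxx.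
Qed.

Lemma bipartitionC F X Y : bipartition F X Y -> bipartition F Y X.
Proof. by case=> defF dXY iX iY; split; rewrite // 1?setUC 1?disjoint_sym. Qed.

Lemma bipartition_nbr F X Y u v :
  bipartition F X Y -> adj F u v -> u \in X -> v \in Y.
Proof.
move=> [defF _ indX _] Fuv Xu; have [_] := adj_verts Fuv.
rewrite -defF inE => /orP[Xv|//].
by have := indX _ _ Xu Xv; rewrite Fuv.
Qed.

End Subgraphs.

(** * From a generating family to an independent [1,2]-set *)

Section FamilyToSet.
Variable V : finType.

(** The independent [1,2]-set is the union of the sets Y j. *)
Lemma family_independent12 (G T : graph V) t (F : 'I_t -> graph V)
    (X Y : 'I_t -> {set V}) :
  cactus G -> spanning_tree G T -> generating_family T F X Y ->
  (forall e, e \in edges G :\: edges T -> typeA X e \/ typeB F X Y e) ->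
  independent12 G (\bigcup_(j < t) Y j).
Proof.
move=> cacG [TG sTG _] [_ FP disF defT [A [_ defET AP]]] typ.
set S := \bigcup_(j < t) Y j.
have XF i x : x \in X i -> x \in verts (F i).
  by have [_ [<- _ _ _] _] := FP i; rewrite inE => ->.
have YF i x : x \in Y i -> x \in verts (F i).
  by have [_ [<- _ _ _] _] := FP i; rewrite inE orbC => ->.
have Funiq i j x : x \in verts (F i) -> x \in verts (F j) -> i = j.
  move=> Fi Fj; apply/eqP; apply: contraT => /disF/disjoint_setI0/setP/(_ x).
  by rewrite !inE Fi Fj.
have XS i x : x \in X i -> x \in S -> False.
  move=> Xx /bigcupP[j _ Yx].
  have ij := Funiq i j x (XF _ _ Xx) (YF _ _ Yx); subst j.
  have [_ [_ /disjoint_setI0/setP/(_ x) + _ _] _] := FP i.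
  by rewrite !inE Xx Yx.
have sFT i : edges (F i) \subset edges T.
  by rewrite defET; apply: subsetU; rewrite (bigcup_sup i).
(* Each edge with an end in S joins Y j to X j for a single j: the edges in A
   and those of type A avoid S. *)
have edgeS u v : adj G u v -> u \in S -> exists j,
    [/\ u \in Y j, v \in X j
      & adj (F j) v u \/ leaf (F j) v /\ [set v; u] \notin edges T].
  move=> Guv Su; have [Tuv|nTuv] := boolP ([set u; v] \in edges T).
    move: Tuv; rewrite defET inE => /orP[/bigcupP[j _ Fuv]|/AP].
      have [_ bip _] := FP j; exists j.
      have [Fu Fv] := adj_verts Fuv.
      have Yu : u \in Y j.
        have [defF _ _ _] := bip; move: Fu; rewrite -defF inE => /orP[Xu|//].
        by case: (XS _ _ Xu Su).
      split=> //; last by left; rewrite adj_sym.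
      exact: bipartition_nbr (bipartitionC bip) Fuv Yu.
    move=> [x [y [i [j [/eq_set2[] [eu ev] _ Xx Xy]]]]]; subst x y.
      by case: (XS _ _ Xx Su).
    by case: (XS _ _ Xy Su).
  have /typ[]: [set u; v] \in edges G :\: edges T by rewrite inE nTuv.
    move=> /subsetP/(_ u); rewrite set21 => /(_ isT)/bigcupP[j _ Xu].
    by case: (XS _ _ Xu Su).
  move=> [x [y [j [/eq_set2[][eu ev] lfx Xx Yy]]]]; subst x y.
    by case: (XS _ _ Xx Su).
  by exists j; split=> //; right; rewrite setUC.
split.
- rewrite -TG defT; apply/bigcupsP=> j _; apply/subsetP=> x /YF Fx.
  by apply/bigcupP; exists j.
- move=> u v Su Sv; apply/negP=> Guv.
  by have [j [_ Xv _]] := edgeS _ _ Guv Su; apply: XS Xv Sv.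
move=> v /setDP[Gv nSv].
have [j Xv] : exists j, v \in X j.
  move: Gv; rewrite -TG defT => /bigcupP[j _]; have [_ [<- _ _ _] _] := FP j.
  case/setUP=> [|Yv]; first by exists j.
  by case/bigcupP: nSv; exists j.
have [[[conF _] F2 _] bip [_ /(_ v Xv) deg2]] := FP j.
have sFG : edges (F j) \subset edges G by apply: subset_trans sTG.
have nbrS w : w \in nbrs G v :&: S ->
    w \in Y j /\ (adj (F j) v w \/ leaf (F j) v /\ [set v; w] \notin edges T).
  rewrite !inE adj_sym => /andP[Gwv Sw].
  have [i [Yw Xv' wP]] := edgeS _ _ Gwv Sw.
  by have ij := Funiq i j v (XF _ _ Xv') (XF _ _ Xv); subst i.
apply/andP; split.
  rewrite card_gt0; apply/set0Pn.
  have [w Fvw] := connected_has_nbr conF F2 (XF _ _ Xv).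
  exists w; rewrite !inE [adj G v w](subsetP sFG) //=.
  by apply/bigcupP; exists j => //; apply: bipartition_nbr bip Fvw Xv.
have [/eqP lfv|nlf] := boolP (deg (F j) v == 1); last first.
  apply: leq_trans deg2; apply/subset_leq_card/subsetP=> w /nbrS[_].
  by case=> [|[/eqP]]; [rewrite inE | rewrite (negPf nlf)].
(* At a leaf: one neighbour in F j, and at most one chord of F j. *)
rewrite -(cardsID (nbrs (F j) v)) -addn1 leq_add //.
  by rewrite -[X in _ <= X]lfv subset_leq_card // subsetIr.
apply/card_le1_eqP=> w1 w2 /setDP[S1 n1] /setDP[S2 n2].
have [Y1 _] := nbrS _ S1; have [Y2 _] := nbrS _ S2.
move: S1 n1 S2 n2; rewrite !inE => /andP[G1 _] n1 /andP[G2 _] n2.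
by apply: (cactus_one_chord cacG conF sFG lfv (YF _ _ Y2) (YF _ _ Y1)).
Qed.

End FamilyToSet.

(** * From an independent [1,2]-set to a generating family *)

Section SetToFamily.
Variable V : finType.

(** E is a spanning forest of the bipartite graph H formed by the edges of G
    that meet S. *)
Lemma independent12_forest (G : graph V) (S : {set V}) :
  independent12 G S ->
  exists E : {set {set V}},
    [/\ E \subset edges G, acyclic E,
        forall u v, adj G u v -> v \in S -> connect (eadj E) u v
      & forall u v, eadj E u v -> u \notin S -> v \in S].
Proof.
move=> [_ indS _]; pose H := [set e in edges G | e :&: S != set0].
have acyclic0 : acyclic (set0 : {set {set V}}).
  by move=> [|x c] [//= _ /andP[/= + _]]; case: c => [|y c] /=; rewrite /eadj inE.
have [|E [sEH acE cE _ _]] := @forest_extension _ set0 H (verts G) _ acyclic0.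
  by move=> u v; rewrite /eadj inE => /andP[/adj_verts[]].
rewrite set0U in acE cE; exists E; split=> //.
- by apply: subset_trans sEH _; apply/subsetP=> e; rewrite inE => /andP[].
- move=> u v Guv Sv; apply: cE; rewrite /eadj inE [_ \in _]Guv /=.
  by apply/set0Pn; exists v; rewrite inE set22.
move=> u v /(subsetP sEH); rewrite inE => /andP[_ /set0Pn[x]].
by rewrite !inE => /andP[/orP[]/eqP-> // ->].
Qed.

(** The pieces are the components of E, and the spanning tree is E completed by
    a set A of edges between different components. *)
Lemma independent12_family (G : graph V) (S : {set V}) :
  connected G -> 1 < #|verts G| -> independent12 G S ->
  exists T : graph V, spanning_tree G T /\
    exists t (F : 'I_t -> graph V) (X Y : 'I_t -> {set V}),
      [/\ generating_family T F X Y, forall j, independent12 (F j) (Y j)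
        & forall e, e \in edges G :\: edges T -> typeA X e \/ typeB F X Y e].
Proof.
move=> conG G2 iS; have [sSG indS domS] := iS.
have [E [sEG acE cES E_S]] := independent12_forest iS.
set W := verts G; set t := #|comps E W|.
have GW u v : eadj (edges G) u v -> u \in W by case/(@adj_verts V G).
have [A [sAG acEA cEA cardA joinA]] := forest_extension GW acE.
have sEAG : E :|: A \subset edges G by rewrite subUset sEG.
pose T := edge_subgraph G (E :|: A); pose E' := edge_subgraph G E.
have edT : edges T = E :|: A by apply/setIidPr.
have edE : edges E' = E by apply/setIidPr.
pose C (i : 'I_t) : {set V} := enum_val i.
pose F i := induced E' (C i).
pose X i := C i :\: S; pose Y i := C i :&: S.
have CP i : exists2 v, v \in W & C i = comp E v.
  by have /imsetP[v] := enum_valP i; exists v.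
have mem_C v : v \in W -> exists i, C i = comp E v.
  move=> Wv; exists (enum_rank_in (mem_comps E Wv) (comp E v)).
  by rewrite /C enum_rankK_in ?mem_comps.
have C_comp i v : v \in C i -> C i = comp E v.
  have [w _ ->] := CP i; rewrite inE -comp_eq; exact/eqP.
have C_self v : v \in comp E v by rewrite inE connect0.
have C_inj i j v : v \in C i -> v \in C j -> i = j.
  by move=> /C_comp Ci /C_comp Cj; apply: enum_val_inj; rewrite -/(C i) Ci.
have C_edge i u v : v \in C i -> connect (eadj E) v u -> u \in C i.
  by move=> /C_comp-> cvu; rewrite inE.
have CW i : C i \subset W.
  have [v Wv ->] := CP i; apply/subsetP=> w; rewrite inE => cvw.
  have [<- //|vw] := eqVneq v w.
  rewrite connect_eadj_sym eq_sym in cvw vw.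
  by have [x /(eadjS sEG)/GW] := connect_step cvw vw.
have adjF i u v : adj (F i) u v = [&& eadj E u v, u \in C i & v \in C i].
  by rewrite adj_induced /adj edE.
(* No vertex is isolated in E, since each one has an edge of G that meets S: a
   vertex outside S because S dominates it, a vertex of S because G is
   connected. *)
have X_nbr i u : u \in X i -> exists v, adj (F i) u v.
  case/setDP=> Cu nSu; have Wu := subsetP (CW i) _ Cu.
  have /domS/andP[+ _] : u \in W :\: S by rewrite inE nSu.
  rewrite card_gt0 => /set0Pn[v]; rewrite !inE => /andP[Guv Sv].
  have uv : u != v by apply: contraNneq nSu => ->.
  have [w Euw] := connect_step (cES _ _ Guv Sv) uv.
  by exists w; rewrite adjF Euw Cu (C_edge _ _ _ Cu) ?connect1.
have Y_nbr i u : u \in Y i -> exists v, adj (F i) u v.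
  case/setIP=> Cu Su; have Wu := subsetP (CW i) _ Cu.
  have [v Guv] := connected_has_nbr conG G2 Wu.
  have := cES v u; rewrite connect_eadj_sym adj_sym => /(_ Guv Su) cuv.
  have [w Euw] := connect_step cuv (adj_neq Guv).
  by exists w; rewrite adjF Euw Cu (C_edge _ _ _ Cu) ?connect1.
have F_nbr i u : u \in X i -> nbrs (F i) u \subset nbrs G u :&: S.
  move=> /setDP[_ nSu]; apply/subsetP=> v; rewrite !inE adjF => /and3P[Euv _ _].
  by rewrite [adj G u v](eadjS sEG) //= (E_S _ _ Euv).
have F_deg i u : u \in X i -> deg (F i) u <= 2.
  move=> Xu; apply: leq_trans (subset_leq_card (F_nbr _ _ Xu)) _.
  have /setDP[Cu nSu] := Xu.
  by have /domS/andP[] : u \in W :\: S by rewrite inE nSu (subsetP (CW i)).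
have bipF i : bipartition (F i) (X i) (Y i).
  split.
  - by rewrite setUC /= setID.
  - rewrite -setI_eq0; apply/eqP/setP=> x; rewrite !inE.
    by case: (x \in S); rewrite ?andbF.
  - move=> u v /setDP[_ nSu] /setDP[_ /negP nSv]; apply/negP.
    by rewrite adjF => /and3P[/E_S/(_ nSu)].
  - move=> u v /setIP[_ Su] /setIP[_ Sv]; rewrite adjF.
    apply: contra (indS _ _ Su Sv) => /and3P[Euv _ _].
    exact: eadjS Euv.
have p2F i : p2_set (F i) (X i) by split; [exists (Y i) | apply: F_deg].
have has_nbr i u : u \in C i -> exists v, adj (F i) u v.
  move=> Cu; have [Su|nSu] := boolP (u \in S).
    by apply: Y_nbr; rewrite inE Cu.
  by apply: X_nbr; rewrite inE nSu.
have p2T i : p2_tree (F i).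
  have [v Wv defC] := CP i; split; last by exists (X i).
  - split.
      by rewrite /F defC -edE; apply: induced_comp_connected.
    move=> c; apply: acyclicS acE c.
    by apply/subsetP=> e; rewrite !inE => /andP[/andP[]].
  have Cv : v \in C i by rewrite defC.
  have [w Fvw] := has_nbr _ _ Cv; have [_ Cw] := adj_verts Fvw.
  by apply/card_gt1P; exists v, w; rewrite ?(adj_neq Fvw).
have conT : connected T.
  move=> u v Wu Wv; have := conG u v Wu Wv.
  by apply: connect_sub => x y /cEA; rewrite -edT.
have one_comp : #|comps (E :|: A) W| = 1.
  have /set0Pn[w Ww] : W != set0 by rewrite -card_gt0 ltnW.
  apply/eqP/cards1P; exists (comp (E :|: A) w); apply/setP=> B; rewrite inE.
  apply/imsetP/eqP=> [[v Wv ->]|->]; last by exists w.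
  by apply/eqP; rewrite comp_eq -edT; apply: conT.
exists T; split.
  split=> //; first exact: subsetIl.
  by split=> // c; apply: acyclicS acEA c; rewrite edT.
exists t, F, X, Y; split.
- split=> //.
  + by rewrite /t -cardA one_comp addn1.
  + move=> i j; apply: contraR; rewrite -setI_eq0 => /set0Pn[v /setIP[Ci Cj]].
    exact/eqP/(C_inj _ _ v).
  + apply/setP=> v; apply/idP/bigcupP=> [/mem_C[i Ci]|[i _ /(subsetP (CW i))//]].
    by exists i; rewrite //= Ci.
  exists A; split.
  + by rewrite /t -cardA one_comp addn1.
  + rewrite edT; congr (_ :|: _); apply/setP=> e; apply/idP/bigcupP; last first.
      by case=> i _; rewrite inE edE => /andP[].
    move=> Ee; have [u [v [def_e Guv]]] := edge_adj (subsetP sEG _ Ee).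
    have [i Ci] := mem_C _ (GW _ _ Guv); have Cu : u \in C i by rewrite Ci.
    exists i => //; rewrite def_e -[_ \in _]/(adj (F i) u v).
    have Euv : eadj E u v by rewrite /eadj -def_e.
    by rewrite adjF Euv Cu (C_edge _ _ _ Cu) ?connect1.
  move=> e Ae; have [u [v [def_e Guv]]] := edge_adj (subsetP sAG _ Ae).
  (* An edge meeting S has its ends connected in E, so it cannot be in A. *)
  have ncuv : ~~ connect (eadj E) u v by apply: joinA; rewrite /eadj -def_e.
  have Gvu : adj G v u by rewrite adj_sym.
  have [i Ci] := mem_C _ (GW _ _ Guv); have [j Cj] := mem_C _ (GW _ _ Gvu).
  have nSv : v \notin S by apply: contra ncuv; apply: cES.
  have nSu : u \notin S.
    by apply: contra ncuv; rewrite connect_eadj_sym; apply: cES.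
  exists u, v, i, j; split=> //; first 1 last.
  + by rewrite inE nSu Ci C_self.
  + by rewrite inE nSv Cj C_self.
  by apply: contra ncuv => /eqP ij; rewrite -comp_eq -Ci -Cj ij.
- move=> i; have [_ _ _ iY] := bipF i; split=> //; first exact: subsetIl.
  move=> v /setDP[/= Cv nYv].
  have Xv : v \in X i by move: nYv; rewrite !inE Cv => ->.
  have [w Fvw] := has_nbr _ _ Cv.
  apply/andP; split.
    rewrite card_gt0; apply/set0Pn; exists w; rewrite inE inE Fvw.
    exact: bipartition_nbr (bipF i) Fvw Xv.
  by apply: leq_trans (F_deg _ _ Xv); apply/subset_leq_card/subsetIl.
move=> e /setDP[Ge nTe].
have [eS|] := boolP (e :&: S == set0).
  left; apply/subsetP=> v ev; have [_ /subsetP sub] := edgesP Ge.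
  have [i Ci] := mem_C _ (sub v ev); apply/bigcupP; exists i => //.
  rewrite inE Ci C_self andbT; apply: contraL eS => Sv.
  by apply/set0Pn; exists v; rewrite inE ev.
case/set0Pn=> v /setIP[ev Sv]; right.
have [u def_e] : exists u, e = [set u; v].
  have [x [y [def_e _]]] := edge_adj Ge; move: ev; rewrite def_e !inE.
  by case/orP=> /eqP->; [exists y; rewrite setUC | exists x].
rewrite {e ev}def_e in Ge nTe *.
have nSu : u \notin S.
  by apply: contraL Ge => Su; apply: indS.
have cuv := cES _ _ Ge Sv; have [i Ci] := mem_C _ (GW _ _ Ge).
have Cu : u \in C i by rewrite Ci.
have Cv : v \in C i by apply: C_edge cuv.
have Xu : u \in X i by rewrite inE nSu.
exists u, v, i; split; rewrite // ?inE ?Cv //.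
apply/eqP; rewrite eqn_leq; apply/andP; split; last first.
  by have [w Fuw] := has_nbr _ _ Cu; apply/card_gt0P; exists w; rewrite inE.
(* u has at most two neighbours in S, and v is one that F i does not use. *)
rewrite -ltnS.
have : #|nbrs G u :&: S| <= 2.
  by have /domS/andP[] : u \in W :\: S by rewrite inE nSu (GW _ _ Ge).
apply: leq_trans; apply: proper_card; rewrite properE F_nbr //=.
apply/subsetPn; exists v; first by rewrite !inE [adj G u v]Ge.
rewrite inE adjF; apply: contra nTe => /and3P[Euv _ _].
by rewrite edT inE [_ \in E]Euv.
Qed.

End SetToFamily.

Theorem theorem2 (V : finType) (G : graph V) (hG : cactus G)
    (hn : 1 < #|verts G|) :
  (exists S : {set V}, independent12 G S) <->
  (exists T : graph V,
     [/\ spanning_tree G T, in_F2 T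
       & exists (t : nat) (F : 'I_t -> graph V) (X Y : 'I_t -> {set V}),
           [/\ generating_family T F X Y,
               forall j, independent12 (F j) (Y j)
             & forall e, e \in edges G :\: edges T ->
                 typeA X e \/ typeB F X Y e]]).
Proof.
split=> [[S iS]|[T [spanT _ [t [F [X [Y [genT _ typ]]]]]]]].
  have [T [spanT [t [F [X [Y [genT iY typ]]]]]]] :=
    independent12_family hG.1 hn iS.
  exists T; split=> //; last by exists t, F, X, Y.
  by have [_ _ treeT] := spanT; split=> //; exists t, F, X, Y.
exists (\bigcup_(j < t) Y j).
exact: family_independent12 hG spanT genT typ.
Qed.
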